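(* For families of indeterminates $\mathsf a=(\mathsf a_{\ell,\ell'})_{\ell,\ell'\ge0}$, $\mathsf b=(\mathsf b_\ell)_{\ell\ge0}$, $\mathsf d=(\mathsf d_{\ell,\ell'})_{\ell,\ell'\ge0}$, $\mathsf e=(\mathsf e_\ell)_{\ell\ge0}$ and $n\ge0$ define $$B_n(\mathsf a,\mathsf b,\mathsf d,\mathsf e)=\sum_{\pi\in\Pi_n}\;\prod_{i\in\mathrm{openers}}\mathsf a_{\mathrm{cr}(i,\pi),\,\mathrm{ne}(i,\pi)}\prod_{i\in\mathrm{closers}}\mathsf b_{\mathrm{qne}(i,\pi)}\prod_{i\in\mathrm{insiders}}\mathsf d_{\mathrm{cr}(i,\pi),\,\mathrm{ne}(i,\pi)}\prod_{i\in\mathrm{singletons}}\mathsf e_{\mathrm{qne}(i,\pi)}.$$ Then the ordinary generating function of the polynomials $B_n(\mathsf a,\mathsf b,\mathsf a,\mathsf b)$ (i.e. with $\mathsf d=\mathsf a$ and $\mathsf e=\mathsf b$) has the S-type continued fraction $$\sum_{n=0}^\infty B_n(\mathsf a,\mathsf b,\mathsf a,\mathsf b)\,t^n=\cfrac{1}{1-\cfrac{\alpha_1t}{1-\cfrac{\alpha_2t}{1-\cfrac{\alpha_3t}{1-\cdots}}}}$$ with coefficients, for $k\ge1$, $$\alpha_{2k-1}=\mathsf b_{k-1},\qquad\alpha_{2k}=\mathsf a^\star_{k-1},\qquad\text{where }\mathsf a^\star_{k-1}=\sum_{\ell=0}^{k-1}\mathsf a_{\ell,k-1-\ell}.$$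
   Context: $\Pi_n$ is the set of partitions of $[n]=\{1,\dots,n\}$ into nonempty blocks. Continued fractions are identities of formal power series in $t$. For $\pi\in\Pi_n$, an element $i\in[n]$ is an opener if it is the smallest element of a block of size $\ge2$; a closer if it is the largest element of a block of size $\ge2$; an insider if it is a non-opener non-closer element of a block of size $\ge3$; a singleton if it is the sole element of a block of size 1. $\mathcal G_\pi$ is the graph on vertex set $[n]$ whose edges join consecutive elements within the same block; edges are written $(i,j)$ with $i<j$. For $j\in[n]$ define $\mathrm{cr}(j,\pi)=\#\{i<j<k<l:\ (i,k)\in\mathcal G_\pi,\ (j,l)\in\mathcal G_\pi\}$, $\mathrm{ne}(j,\pi)=\#\{i<j<k<l:\ (i,l)\in\mathcal G_\pi,\ (j,k)\in\mathcal G_\pi\}$, $\mathrm{qne}(j,\pi)=\#\{i<j<l:\ (i,l)\in\mathcal G_\pi\}$ (in each case $j$ is fixed and the other indices vary). *)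

(* Defs.v *)
From mathcomp Require Import all_boot all_order all_algebra.

Set Implicit Arguments.
Unset Strict Implicit.
Unset Printing Implicit Defensive.

Import GRing.Theory.
Local Open Scope ring_scope.

(* The series [\sum_n f n t^n] is represented by its coefficient sequence [f]. *)
Definition fps (R : comNzRingType) := nat -> R.

Section FormalPowerSeries.
Variable R : comNzRingType.
Implicit Types (f g h : fps R) (c : R) (n k m : nat).

Definition fps_one : fps R := fun n => (n == 0%N)%:R.
Definition fps_sub f g : fps R := fun n => f n - g n.
Definition fps_mul f g : fps R := fun n => \sum_(i < n.+1) f i * g (n - i)%N.
Definition fps_exp f k : fps R := iter k (fps_mul f) fps_one.

(* [c * t * f] *)
Definition fps_scale_shift c f : fps R :=
  fun n => if n is n'.+1 then c * f n' else 0.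

(* The inverse of a series with constant term 1, as the geometric series
   [\sum_k (1 - f)^k]; only the terms with [k <= n] contribute to the
   coefficient of [t^n].  See [fps_mulfV] for its correctness. *)
Definition fps_inv f : fps R :=
  fun n => \sum_(k < n.+1) fps_exp (fps_sub fps_one f) k n.

(* Convergence in the t-adic topology: every coefficient is eventually
   constant, with the prescribed value. *)
Definition fps_converges (F : nat -> fps R) f : Prop :=
  forall n, exists M, forall m, (M <= m)%N -> F m n = f n.

Lemma fps_exp_low g k n : g 0%N = 0 -> (n < k)%N -> fps_exp g k n = 0.
Proof.
move=> g0; elim: k n => // k IHk n lt_nk /=.
rewrite /fps_exp /= -/(fps_exp g k) /fps_mul big_ord_recl g0 mul0r add0r.
rewrite big1 // => i _; rewrite IHk ?mulr0 //= /bump leq0n add1n.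
by case: n lt_nk i => [|n] lt_nk [i //= lt_i];
  rewrite subSS; apply: leq_ltn_trans (leq_subr _ _) _.
Qed.

Lemma fps_mulfV f : f 0%N = 1 -> fps_mul f (fps_inv f) =1 fps_one.
Proof.
move=> f0 n; set g := fps_sub fps_one f.
have g0 : g 0%N = 0 by rewrite /g /fps_sub f0 subrr.
have fE i : f i = fps_one i - g i by rewrite /g /fps_sub opprB addrC subrK.
have invE m : (m <= n)%N -> fps_inv f m = \sum_(0 <= k < n.+1) fps_exp g k m.
  move=> le_mn; rewrite (big_cat_nat (n := m.+1)) //=.
  rewrite big_mkord [X in _ + X]big_nat [X in _ + X]big1 ?addr0 // => k.
  by case/andP=> lt_mk _; apply: fps_exp_low.
have one_mul h : fps_mul fps_one h n = h n.
  rewrite /fps_mul big_ord_recl /fps_one /= mul1r subn0 big1 ?addr0 // => i _.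
  by rewrite mul0r.
transitivity (\sum_(0 <= k < n.+1) (fps_exp g k n - fps_exp g k.+1 n)).
  rewrite /fps_mul.
  under eq_bigr => i _ do rewrite (invE _ (leq_subr _ _)) mulr_sumr.
  rewrite exchange_big; apply: eq_bigr => k _ /=.
  rewrite -[in fps_exp g k n]one_mul /fps_exp /= /fps_mul -sumrB.
  by apply: eq_bigr => i _; rewrite fE mulrBl.
rewrite -[LHS]opprK -sumrN; under eq_bigr do rewrite opprB.
by rewrite telescope_sumr // opprB [X in _ - X](fps_exp_low g0) // subr0.
Qed.

(* The finite continued fraction with [m] levels
   [1/(1 - alpha_k t/(1 - alpha_(k+1) t/( ... /(1 - alpha_(k+m-1) t))))]. *)
Fixpoint sfrac_convergent (alpha : nat -> R) k m : fps R :=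
  if m is m'.+1 then
    fps_inv (fps_sub fps_one
      (fps_scale_shift (alpha k) (sfrac_convergent alpha k.+1 m')))
  else fps_one.

(* [f = 1/(1 - alpha_1 t/(1 - alpha_2 t/(1 - ...)))]; [alpha 0] is not used. *)
Definition has_sfrac f (alpha : nat -> R) : Prop :=
  fps_converges (sfrac_convergent alpha 1) f.

End FormalPowerSeries.

(* The ground set [1..n] is represented by ['I_n], that is, shifted by one;
   all notions below depend only on the relative order of the elements. *)
Section SetPartitions.
Variables (n : nat) (P : {set {set 'I_n}}).
Implicit Types (i j k l : 'I_n) (B : {set 'I_n}).

Definition opener i : bool :=
  [exists B in P, [&& (1 < #|B|)%N, i \in B & [forall j in B, (i <= j)%N]]].

Definition closer i : bool :=
  [exists B in P, [&& (1 < #|B|)%N, i \in B & [forall j in B, (j <= i)%N]]].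

Definition insider i : bool :=
  [&& [exists B in P, (2 < #|B|)%N && (i \in B)], ~~ opener i & ~~ closer i].

Definition singleton i : bool := [set i] \in P.

Definition edge i j : bool :=
  [exists B in P, [&& i \in B, j \in B, (i < j)%N &
                      [forall k in B, ~~ (i < k < j)%N]]].

Definition cr j : nat :=
  #|[set x : 'I_n * 'I_n * 'I_n | let: (i, k, l) := x in
      [&& (i < j)%N, (j < k)%N, (k < l)%N, edge i k & edge j l]]|.

Definition ne j : nat :=
  #|[set x : 'I_n * 'I_n * 'I_n | let: (i, k, l) := x in
      [&& (i < j)%N, (j < k)%N, (k < l)%N, edge i l & edge j k]]|.

Definition qne j : nat :=
  #|[set x : 'I_n * 'I_n | let: (i, l) := x in
      [&& (i < j)%N, (j < l)%N & edge i l]]|.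

End SetPartitions.

Definition Bpoly (R : comNzRingType) (a : nat -> nat -> R) (b : nat -> R)
    (d : nat -> nat -> R) (e : nat -> R) (n : nat) : R :=
  \sum_(P : {set {set 'I_n}} | partition P [set: 'I_n])
    (\prod_(i | opener P i) a (cr P i) (ne P i)) *
    (\prod_(i | closer P i) b (qne P i)) *
    (\prod_(i | insider P i) d (cr P i) (ne P i)) *
    (\prod_(i | singleton P i) e (qne P i)).

(* Main.v *)
Require Import Defs.
From mathcomp Require Import all_boot all_order all_algebra.
From mathcomp Require Import zify.

(** The weight of a set partition only sees its arcs, that is, the pairs of
    consecutive elements of a block: with [d = a] and [e = b], an element [i] has
    weight [a (cr i) (ne i)] if an arc leaves it to the right, and [b (qne i)]
    otherwise ([role_weight]).  A partition is the same as its system of arcs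
    ([block_next_mapK], [last_partitionK]), so that [Bpoly] is a sum over the
    systems of arcs ([Bpoly_arc_maps]).

    The elements are read from the largest to the smallest.  The state is the
    set of the targets already met whose arc has not yet found its source.  If
    [h] arcs are pending when [i] is read, and no arc leaves [i], then all of
    them pass over [i] and [qne i = h].  If an arc leaves [i], it is one of the
    pending ones; the other ones pass over [i], and they cross or nest with the
    arc of [i] according to the position of their target.  So
    [cr i + ne i = h - 1], each value of [cr i] arises from one choice, and these
    choices have total weight [\sum_l a l (h - 1 - l)] ([sum_ranks]).  Finally
    [i] may itself be the target of a new pending arc.  Thus the sum
    only depends on the number of pending arcs and of elements left
    ([prefix_sum_histories]), and it satisfies the recurrence that defines
    [histories].

    The continued fraction has the same expansion.  If [C_k] is its tail that
    starts with [alpha k], then [C_k = 1 + alpha_k t C_k C_(k+1)], so that the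
    products [G_k = C_1 * ... * C_k] satisfy the linear recurrence
    [G_(k+1) = G_k + alpha_(k+1) t G_(k+2)].  Their coefficients count weighted
    lattice paths ([has_sfrac_path_sum]), and a history is such a path with two
    steps for each element ([histories_path_sum]). *)

Set Implicit Arguments.
Unset Strict Implicit.
Unset Printing Implicit Defensive.

Import GRing.Theory.
Local Open Scope ring_scope.

(** * Path expansion of the continued fraction *)

Section ContinuedFraction.
Variable R : comNzRingType.
Implicit Types (f g h : fps R) (alpha : nat -> R).

Lemma fps_mul_poly f g n N : (n < N)%N ->
  fps_mul f g n = ((\poly_(i < N) f i) * (\poly_(i < N) g i))`_n.
Proof.
move=> lt_nN; rewrite coefM; apply: eq_bigr => i _; rewrite !coef_poly.
by rewrite !ifT //; have := ltn_ord i; lia.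
Qed.

Lemma fps_mulC f g : fps_mul f g =1 fps_mul g f.
Proof. by move=> n; rewrite !(fps_mul_poly _ _ (ltnSn n)) mulrC. Qed.

Lemma fps_mulA f g h : fps_mul f (fps_mul g h) =1 fps_mul (fps_mul f g) h.
Proof.
move=> n; transitivity ((\poly_(i < n.+1) f i * \poly_(i < n.+1) g i *
                         \poly_(i < n.+1) h i)`_n).
  rewrite -mulrA coefM; apply: eq_bigr => i _.
  by rewrite coef_poly ltn_ord (@fps_mul_poly _ _ _ n.+1) //; have := ltn_ord i; lia.
rewrite coefM; apply: eq_bigr => i _.
by rewrite coef_poly (@fps_mul_poly _ _ _ n.+1) // ifT //; have := ltn_ord i; lia.
Qed.

Lemma fps_mul1 f : fps_mul f (fps_one R) =1 f.
Proof.
move=> n; rewrite fps_mulC /fps_mul big_ord_recl /fps_one /= mul1r subn0.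
by rewrite big1 ?addr0 // => i _; rewrite mul0r.
Qed.

Lemma sfrac_convergent0 alpha k m : sfrac_convergent alpha k m 0 = 1.
Proof.
case: m => [|m] //=; rewrite /fps_inv big_ord_recl big_ord0 addr0.
by rewrite /fps_exp /= /fps_one.
Qed.

(** With [C] and [C'] consecutive tails of the fraction, [C = 1/(1 - alpha t C')]
    is the quadratic relation [C = 1 + alpha t C C'], which involves no inverse. *)
Lemma sfrac_convergentS alpha k m n :
  sfrac_convergent alpha k m.+1 n.+1 =
  alpha k * fps_mul (sfrac_convergent alpha k m.+1)
                    (sfrac_convergent alpha k.+1 m) n.
Proof.
set C := sfrac_convergent alpha k m.+1.
set g := fps_scale_shift (alpha k) (sfrac_convergent alpha k.+1 m).
have /(_ n.+1) : fps_mul (fps_sub (fps_one R) g) C =1 fps_one R.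
  by apply: fps_mulfV; rewrite /fps_sub /g /= subr0.
rewrite /fps_mul big_ord_recl /fps_sub {1}/fps_one /= subr0 mul1r subn0.
rewrite /fps_one /= => /eqP; rewrite addr_eq0 => /eqP ->.
rewrite -sumrN -/(fps_mul _ _ n) fps_mulC /fps_mul mulr_sumr.
by apply: eq_bigr => i _; rewrite /= /bump add1n subSS sub0r mulNr opprK mulrA.
Qed.

(** The product [C_1 * ... * C_k] of the tails of the fraction; for a level [K]
    at which the fraction is cut off, [C_j] has [K - j] levels. *)
Fixpoint sfrac_prod alpha K k : fps R :=
  if k is k'.+1 then
    fps_mul (sfrac_prod alpha K k') (sfrac_convergent alpha k (K - k))
  else fps_one R.

(** The coefficient of [t^n] in [C_1 * ... * C_k] for the infinite fraction.
    Equivalently, the sum over the lattice paths from [k] that stop on reaching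
    [0] and have [n] rises, where falls have weight 1 and the rise from [j.+1]
    to [j.+2] has weight [alpha j.+1]: here [j.+1] is the point reached by the
    falls that precede the first rise. *)
Fixpoint path_sum alpha n k : R :=
  if n is n'.+1 then \sum_(j < k) alpha j.+1 * path_sum alpha n' j.+2 else 1.

(** The Euler-Gauss recurrence: multiplying [C_(k+1) = 1 + alpha_(k+1) t C_(k+1)
    C_(k+2)] by [C_1 * ... * C_k] makes the quadratic relation linear. *)
Lemma sfrac_prodS alpha K k n : (k.+1 < K)%N ->
  sfrac_prod alpha K k.+1 n.+1 =
  sfrac_prod alpha K k n.+1 + alpha k.+1 * sfrac_prod alpha K k.+2 n.
Proof.
move=> lt_kK /=; rewrite {1}/fps_mul big_ord_recr /= subnn sfrac_convergent0.
rewrite mulr1 addrC; congr (_ + _).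
rewrite -fps_mulA /fps_mul mulr_sumr; apply: eq_bigr => i _.
rewrite -/(fps_mul _ _ _) subSn -1?ltnS // -[(K - k.+1)%N]prednK ?subn_gt0 //.
by rewrite sfrac_convergentS mulrCA -subnS.
Qed.

(** The Euler-Gauss recurrence trades an index of coefficient for a factor, so
    a coefficient with [k + n < K] never meets the level of truncation. *)
Lemma sfrac_prod_coef alpha K k n : (k + n < K)%N ->
  sfrac_prod alpha K k n = path_sum alpha n k.
Proof.
elim: n k => [|n IHn] k.
  move=> _; elim: k => //= k IHk.
  by rewrite /fps_mul big_ord_recl big_ord0 addr0 IHk mul1r sfrac_convergent0.
elim: k => [|k IHk] lt_K; first by rewrite /= big_ord0.
rewrite sfrac_prodS; last lia.
rewrite IHk ?IHn /=; try lia.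
by rewrite big_ord_recr.
Qed.

Lemma has_sfrac_path_sum alpha : has_sfrac (fun n => path_sum alpha n 1) alpha.
Proof.
move=> n; exists n.+1 => m le_nm.
have <- : sfrac_prod alpha m.+1 1 n = path_sum alpha n 1.
  by rewrite sfrac_prod_coef //; lia.
by rewrite /= fps_mulC fps_mul1 subn1.
Qed.

(** The sum of the weights of the histories that end with no pending arc, when [m]
    elements are still to be read and [h] arcs are pending.  Reading an element
    first decides whether an arc leaves it: if not, this costs
    [alpha h.*2.+1]; if so, the arc is one of the pending ones, for a total
    cost of [alpha h.*2].  Then the element may itself become the target of
    a new pending arc, at no cost. *)
Fixpoint histories (alpha : nat -> R) (h m : nat) : R :=
  if m is m'.+1 then
    alpha h.*2.+1 * (histories alpha h m' + histories alpha h.+1 m') +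
    (if h is h'.+1 then
       alpha h.*2 * (histories alpha h' m' + histories alpha h m') else 0)
  else (h == 0%N)%:R.

Lemma histories_small alpha (h m : nat) : (m < h)%N -> histories alpha h m = 0.
Proof.
elim: m h => [|m IHm] [|h] //= lt_mh.
by rewrite !IHm ?addr0 ?mulr0 ?addr0 //; lia.
Qed.

Lemma path_sumS alpha n k :
  path_sum alpha n.+1 k.+1 =
  path_sum alpha n.+1 k + alpha k.+1 * path_sum alpha n k.+2.
Proof. by rewrite /= big_ord_recr. Qed.

(** A history with [h] pending arcs is a lattice path that starts at [h.*2.+1],
    makes two steps for each element, and ends with one more fall from [1] to
    [0].  In the first step, an arc that leaves is a fall and no such arc is a
    rise; in the second one, a new pending arc is a rise and none is a fall.
    Histories put the weight [alpha j.*2] on falls whereas [path_sum] puts it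
    on rises.  The path crosses the edge of this weight once more downwards
    than upwards if the edge is below its start, and equally often in both
    directions otherwise; this accounts for the product. *)
Lemma histories_path_sum alpha (h n : nat) :
  histories alpha h (h + n) =
  (\prod_(j < h) alpha j.+1.*2) * path_sum alpha n h.*2.+1.
Proof.
elim: {h n}(h + n)%N {-2}h {-2}n (erefl (h + n)%N) => [|m IHm] h n.
  by move/eqP; rewrite addn_eq0 => /andP[/eqP-> /eqP->]; rewrite big_ord0 mul1r.
(* The two outcomes of the second half of the reading of an element. *)
have pair k p : (k + p)%N = m -> histories alpha k m + histories alpha k.+1 m =
    (\prod_(j < k) alpha j.+1.*2) * path_sum alpha p k.*2.+2.
  move=> e; have := IHm k p e; rewrite e => ->; case: p e => [|p] e.
    by rewrite histories_small ?addr0 //; lia.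
  have e' : (k.+1 + p)%N = m by lia.
  have := IHm k.+1 p e'; rewrite e' => ->.
  by rewrite [path_sum _ _ k.*2.+2]path_sumS big_ord_recr mulrDr mulrA.
move=> e; rewrite e /=; case: n e => [|n] e.
  case: h e => [|h] // e.
  rewrite [_ + histories _ h.+2 m]addrC (pair h 0%N); last lia.
  rewrite !histories_small; try lia.
  rewrite addr0 mulr0 add0r.
  by rewrite big_ord_recr /= [_ * alpha _]mulrC -mulrA.
rewrite (pair _ n); last lia.
rewrite path_sumS; case: h e => [|h] e.
  by rewrite !big_ord0 addr0 !mul1r /= big_ord0 add0r.
rewrite (pair _ n.+1); last lia.
rewrite big_ord_recr -!doubleS mulrDr addrC mulrA; congr (_ + _).
  by rewrite [alpha _ * _]mulrC.
exact: mulrCA.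
Qed.
End ContinuedFraction.

(** * Arc maps and the removal of the last source *)

Section Ranks.
Variables (V : nmodType) (n : nat).
Implicit Types (T : {set 'I_n}) (x y k : 'I_n).

(** Among [h] elements, the numbers of those below and of those above a given one
    run once through the pairs of sum [h - 1].  By induction: when the largest
    element is removed, the second number drops by one for all the others. *)
Lemma sum_ranks (F : nat -> nat -> V) T :
  \sum_(x in T) F #|[set k in T | (k < x)%N]| #|[set k in T | (x < k)%N]| =
  \sum_(0 <= l < #|T|) F l (#|T| - 1 - l)%N.
Proof.
move: {2}#|T| (erefl #|T|) => h; elim: h F T => [|h IHh] F T cardT.
  by rewrite (cards0_eq cardT) cards0 big_geq // big_set0.
have /set0Pn[x0 x0T] : T != set0 by rewrite -card_gt0 cardT.
have [z zT zmax] : exists2 z, z \in T & forall x, x \in T -> (x <= z)%N.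
  by case: (@arg_maxnP _ x0 [in T] val x0T) => z zT zmax; exists z.
have cardT' : #|T :\ z| = h by move: cardT; rewrite (cardsD1 z) zT => -[].
rewrite cardT big_nat_recr //= (big_setD1 z) //= addrC; congr (_ + _).
  transitivity (\sum_(x in T :\ z) F #|[set k in T :\ z | (k < x)%N]|
      #|[set k in T :\ z | (x < k)%N]|.+1).
    apply: eq_bigr => x /setD1P[xz xT]; congr (F _ _).
      apply: eq_card => k; rewrite !inE; case: (eqVneq k z) => //= ->.
      by rewrite ltnNge zmax // andbF.
    rewrite [LHS](cardsD1 z) inE zT /= ltn_neqAle xz zmax // add1n; congr _.+1.
    by apply: eq_card => k; rewrite !inE andbA.
  rewrite (IHh (fun l r => F l r.+1)) // cardT' !big_mkord.
  apply: eq_bigr => i _; congr (F _ _); have := ltn_ord i; lia.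
congr (F _ _); last first.
  rewrite subn1 /= subnn; apply/eqP; rewrite cards_eq0; apply/eqP/setP=> k.
  rewrite !inE; apply/andP => -[kT]; rewrite ltnNge zmax //.
rewrite -cardT'; apply: eq_card => k; rewrite !inE.
case: (boolP (k \in T)) => [kT|]; rewrite ?andbF ?andbT //=.
by rewrite ltn_neqAle zmax // andbT.
Qed.
End Ranks.

Section ArcMaps.
Variable n : nat.
Implicit Types (f g : {ffun 'I_n -> 'I_n}) (T S : {set 'I_n}) (i j k x : 'I_n).

(** A system of disjoint increasing chains on ['I_n]: [f i] is the element that
    follows [i] in its chain, and [f i = i] when [i] is the last one.  An arc is
    a pair [(i, f i)] with [f i != i]; a total map, rather than one into an
    option type, gives the last element of the chain of [i] as an iterate. *)
Definition arc_map f : bool :=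
  [forall i : 'I_n, (i <= f i)%N] &&
  [forall i : 'I_n, forall j : 'I_n, ((i < j)%N && (f i == f j)) ==> (f j == j)].

Definition fixed_from (m : nat) f : bool := [forall i : 'I_n, (m <= i)%N ==> (f i == i)].

(** The arcs that are cut just before [m], represented by their targets: no two
    arcs share a target ([arc_source]), so counting targets counts arcs. *)
Definition dangling f (m : nat) : {set 'I_n} :=
  [set k : 'I_n | (m <= k)%N && [exists i : 'I_n, (i < m)%N && (f i == k)]].

(** The arcs that pass over [i], again represented by their targets; an arc that
    ends at [i] is cut before [i] but does not pass over it. *)
Definition covering f i : {set 'I_n} := dangling f i :\ i.

Lemma arc_mapP f :
  reflect ((forall i, (i <= f i)%N) /\
           (forall i j, (i < j)%N -> f i = f j -> f j = j)) (arc_map f).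
Proof.
apply: (iffP andP) => -[/= le_f inj_f]; split.
- exact/forallP.
- move=> i j lt_ij /eqP eq_f; have /forallP/(_ j) := forallP inj_f i.
  by rewrite lt_ij eq_f => /eqP.
- exact/forallP.
apply/forallP => i; apply/forallP => j; apply/implyP => /andP[lt_ij /eqP eq_f].
by apply/eqP; apply: inj_f eq_f.
Qed.

Lemma fixed_fromP m f :
  reflect (forall i, (m <= i)%N -> f i = i) (fixed_from m f).
Proof.
by apply: (iffP forallP) => H i; [move/(implyP (H i))/eqP | apply/implyP=> /H/eqP].
Qed.

Lemma danglingP f m k :
  reflect ((m <= k)%N /\ exists2 i : 'I_n, (i < m)%N & f i = k) (k \in dangling f m).
Proof.
rewrite inE; apply: (iffP andP) => -[mk].
  by case/existsP => i /andP[im /eqP fi]; split=> //; exists i.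
by case=> i im fi; split=> //; apply/existsP; exists i; rewrite im fi eqxx.
Qed.

Lemma coveringP f i k :
  reflect ((i < k)%N /\ exists2 x : 'I_n, (x < i)%N & f x = k) (k \in covering f i).
Proof.
apply: (iffP setD1P) => [[ki /danglingP[ik ex]]|[ik ex]]; split=> //.
- by rewrite ltn_neqAle eq_sym ki.
- by apply/eqP=> ki; move: ik; rewrite ki ltnn.
- by apply/danglingP; split=> //; apply: ltnW.
Qed.

Lemma arc_source f x (y : 'I_n) k : arc_map f ->
  (x < k)%N -> (y < k)%N -> f x = k -> f y = k -> x = y.
Proof.
case/arc_mapP=> _ f_inj xk yk fx fy.
have half (u v : 'I_n) : (v < k)%N -> f u = k -> f v = k -> (v <= u)%N.
  move=> vk fu fv; rewrite leqNgt; apply/negP=> uv.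
  have := f_inj u v uv; rewrite fu fv => /(_ erefl) kv.
  by move: vk; rewrite kv ltnn.
by apply/val_inj/eqP; rewrite /= eqn_leq !half.
Qed.

Lemma eq_dangling f g m :
  (forall i, (i < m)%N -> f i = g i) -> dangling f m = dangling g m.
Proof.
move=> eq_fg; apply/setP=> k; rewrite !inE; congr (_ && _).
by apply: eq_existsb => i; case: ltnP => //= /eq_fg ->.
Qed.

Definition redirect j x g : {ffun 'I_n -> 'I_n} :=
  [ffun i => if i == j then x else g i].

Lemma redirect_before j x g i : (i < j)%N -> redirect j x g i = g i.
Proof.
move=> lt_ij; rewrite ffunE ifF //; apply/eqP=> ij.
by move: lt_ij; rewrite ij ltnn.
Qed.

Lemma redirect_at j x g : redirect j x g j = x.
Proof. by rewrite ffunE eqxx. Qed.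

(** An arc map with sources at most [j] is an arc map [g] with sources before [j],
    together with the choice of the image [x] of [j]: either [j] itself or a
    position that [g] has not used.  If [T] is to be the dangling set after
    [j], then the dangling set of [g] is [T :\ x], possibly with [j] added. *)
Lemma redirect_good j x g T : (forall k, k \in T -> (j < k)%N) ->
  [&& arc_map (redirect j x g), fixed_from j.+1 (redirect j x g)
    & dangling (redirect j x g) j.+1 == T] && (redirect j j (redirect j x g) == g)
  = (x \in j |: T) &&
    [&& arc_map g, fixed_from j g & dangling g j :\ j == T :\ x].
Proof.
move=> T_gt; set f := redirect j x g.
have f_at : f j = x by apply: redirect_at.
have f_ne i : i != j -> f i = g i by move=> ij; rewrite ffunE (negbTE ij).
have f_lt i : (i < j)%N -> f i = g i by move=> ij; apply: redirect_before.
have f_gt i : (j < i)%N -> f i = g i.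
  by move=> ji; apply: f_ne; apply/eqP=> ij; move: ji; rewrite ij ltnn.
apply/idP/idP.
  case/andP=> /and3P[/arc_mapP[f_le f_inj] /fixed_fromP f_fix /eqP defT] /eqP gE.
  have gj : g j = j by rewrite -gE redirect_at.
  have jx : (j <= x)%N by rewrite -f_at.
  have xT : x \in j |: T.
    rewrite in_setU1; case: eqVneq => //= xj; rewrite -defT; apply/danglingP.
    by split; [rewrite ltn_neqAle eq_sym xj | exists j].
  rewrite xT /=; apply/and3P; split.
  - apply/arc_mapP; split=> [i | i k ik].
      by case: (eqVneq i j) => [->|/f_ne <-]; rewrite ?gj.
    case: (eqVneq k j) => [-> //|kj]; case: (eqVneq i j) ik => [->|ij] ik.
      by move=> _; rewrite -f_gt // f_fix.
    by rewrite -!f_ne //; apply: f_inj.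
  - apply/fixed_fromP => i; rewrite leq_eqVlt => /orP[/eqP/val_inj <- //|ji].
    by rewrite -f_gt // f_fix.
  apply/eqP/setP=> k; apply/setD1P/setD1P => -[].
    move=> kj /danglingP[jk [i ij gi]].
    have lt_jk : (j < k)%N by rewrite ltn_neqAle eq_sym kj.
    split.
      apply/eqP=> kx; move/eqP: kj; apply; rewrite kx -f_at.
      by rewrite (f_inj i j) // f_at f_lt // gi.
    rewrite -defT; apply/danglingP; split=> //; exists i; first exact: ltnW.
    by rewrite f_lt.
  move=> kx kT; have lt_jk := T_gt k kT; split.
    by apply/eqP=> kj; move: lt_jk; rewrite kj ltnn.
  move: kT; rewrite -defT => /danglingP[_ [i]]; rewrite ltnS leq_eqVlt.
  case/orP => [/eqP/val_inj -> fi|ij fi]; first by rewrite -fi f_at eqxx in kx.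
  by apply/danglingP; split; [exact: ltnW | exists i; rewrite -?f_lt].
case/andP=> xT /and3P[/arc_mapP[g_le g_inj] /fixed_fromP g_fix /eqP defD].
have gj : g j = j by apply: g_fix.
have jx : (j <= x)%N by case/setU1P: xT => [->//|/T_gt/ltnW].
(* [T :\ x] does not contain [x], so an image of [g] can only be [x] if it is [j]. *)
have x_new i : (i < j)%N -> g i = x -> x = j.
  move=> ij gi; apply/eqP; apply: contraT => xj.
  have : x \in dangling g j :\ j.
    by rewrite in_setD1 xj; apply/danglingP; split=> //; exists i.
  by rewrite defD in_setD1 eqxx.
apply/andP; split; last first.
  by apply/eqP/ffunP=> i; rewrite ffunE; case: eqVneq => [->|/f_ne].
apply/and3P; split.
- apply/arc_mapP; split=> [i | i k ik].
    by case: (eqVneq i j) => [->|/f_ne ->]; rewrite ?f_at.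
  case: (eqVneq k j) ik => [->|kj] ik.
    by rewrite f_at f_lt // => /x_new; apply.
  case: (eqVneq i j) ik => [->|ij] ik.
    by move=> _; rewrite f_gt // g_fix // ltnW.
  by rewrite !f_ne //; apply: g_inj.
- by apply/fixed_fromP => i ji; rewrite f_gt // g_fix // ltnW.
apply/eqP/setP=> k; apply/danglingP/idP => [[jk [i]]|kT].
  rewrite ltnS leq_eqVlt => /orP[/eqP/val_inj ->|ij].
    rewrite f_at => xk; move: xT; rewrite xk in_setU1; case: eqVneq => //= kj.
    by move: jk; rewrite kj ltnn.
  rewrite f_lt // => gi; suff: k \in T :\ x by case/setD1P.
  rewrite -defD in_setD1; apply/andP; split.
    by apply/eqP=> kj; move: jk; rewrite kj ltnn.
  by apply/danglingP; split; [exact: ltnW | exists i].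
split; first exact: T_gt.
case: (eqVneq k x) => [->|kx]; first by exists j.
have : k \in dangling g j :\ j by rewrite defD in_setD1 kx.
case/setD1P => _ /danglingP[_ [i ij gi]].
by exists i; rewrite ?f_lt // ltnW.
Qed.

End ArcMaps.

(** * Weighted sums over arc maps *)

Section Weights.
Variables (R : comNzRingType) (a : nat -> nat -> R) (b : nat -> R) (n : nat).
Implicit Types (f g : {ffun 'I_n -> 'I_n}) (T S : {set 'I_n}) (i j k x : 'I_n).

(** The weight of an element [i] that is sent to [x] when [T] is the set of targets
    of the arcs passing over [i]. *)
Definition step_weight T i x : R :=
  if x == i then b #|T|
  else a #|[set k in T | (k < x)%N]| #|[set k in T | (x < k)%N]|.

Definition arc_weight f i : R := step_weight (covering f i) i (f i).

(** The statistics of [i] only involve arcs whose source is at most [i]; this is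
    what allows the last source to be split off below. *)
Lemma eq_arc_weight f g i :
  (forall k, (k <= i)%N -> f k = g k) -> arc_weight f i = arc_weight g i.
Proof.
move=> eq_fg; rewrite /arc_weight /covering eq_fg //.
by rewrite (@eq_dangling _ f g) // => k /ltnW/eq_fg.
Qed.

(** The total weight of the ways to draw the arcs whose source is less than [m],
    given the set [T] of their targets that are not less than [m]. *)
Definition prefix_sum (m : nat) T : R :=
  \sum_(f | [&& arc_map f, fixed_from m f & dangling f m == T])
     \prod_(i : 'I_n | (i < m)%N) arc_weight f i.

Lemma prefix_sum0 T : prefix_sum 0 T = (#|T| == 0%N)%:R.
Proof.
have dang0 f : dangling f 0 = set0.
  by apply/setP=> k; rewrite in_set0; apply/danglingP=> -[_ []].
have fix0 f : fixed_from 0 f -> f = [ffun i => i].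
  by move/fixed_fromP=> f0; apply/ffunP=> i; rewrite ffunE f0.
rewrite /prefix_sum cards_eq0 (eq_sym T); case: eqVneq => [<-|T0].
  rewrite (big_pred1 [ffun i => i]) => [|f]; first by rewrite big_pred0.
  rewrite dang0 eqxx andbT; apply/andP/eqP => [[_ /fix0//]|->].
  split; last by apply/fixed_fromP=> i _; rewrite ffunE.
  by apply/arc_mapP; split=> [i|i k ik]; rewrite !ffunE.
by rewrite big_pred0 // => f; rewrite dang0 (negbTE T0) !andbF.
Qed.

(** By [redirect_good], the arcs with an earlier source dangle to [T :\ x] or to
    [j |: (T :\ x)], according to whether [j] is itself a target. *)
Lemma prefix_sumS j T : (forall k, k \in T -> (j < k)%N) ->
  prefix_sum j.+1 T =
  \sum_(x in j |: T) step_weight (T :\ x) j x *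
    (prefix_sum j (T :\ x) + prefix_sum j (j |: (T :\ x))).
Proof.
move=> T_gt; rewrite /prefix_sum.
rewrite (reindex_onto (fun p : 'I_n * {ffun 'I_n -> 'I_n} => redirect j p.1 p.2)
  (fun f => (f j, redirect j j f))) /=; last first.
  by move=> f _; apply/ffunP=> i; rewrite !ffunE; case: eqVneq => [->|].
transitivity (\sum_(p : 'I_n * {ffun 'I_n -> 'I_n} | (p.1 \in j |: T) &&
    [&& arc_map p.2, fixed_from j p.2 & dangling p.2 j :\ j == T :\ p.1])
   step_weight (T :\ p.1) j p.1 * \prod_(i : 'I_n | (i < j)%N) arc_weight p.2 i).
  apply: eq_big => [[x g] | [x g]] /=.
    by rewrite -pair_eqE /= redirect_at eqxx /= redirect_good.
  rewrite -pair_eqE /= redirect_at eqxx /= redirect_good //.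
  case/andP=> _ /and3P[_ _ /eqP defT].
  rewrite (bigD1 j) //=; congr (_ * _).
    rewrite /arc_weight redirect_at; congr (step_weight _ _ _).
    rewrite -defT /covering; congr (_ :\ _).
    by apply: eq_dangling => i; apply: redirect_before.
  apply: eq_big => i; first by rewrite ltnS [RHS]ltn_neqAle andbC.
  move=> /andP[ij ne_ij]; apply: eq_arc_weight => k ki; apply: redirect_before.
  by apply: leq_ltn_trans ki _; rewrite ltn_neqAle ne_ij -ltnS.
rewrite -(pair_big_dep [in j |: T] (fun x g =>
    [&& arc_map g, fixed_from j g & dangling g j :\ j == T :\ x])
   (fun x g => step_weight (T :\ x) j x * \prod_(i : 'I_n | (i < j)%N) arc_weight g i)).
apply: eq_bigr => x _; rewrite -mulr_sumr; congr (_ * _).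
have jS : j \notin T :\ x.
  by apply/negP=> /setD1P[_ /T_gt]; rewrite ltnn.
rewrite (bigID (fun g => j \in dangling g j)) /= addrC.
congr (_ + _); apply: eq_bigl => g; rewrite -!andbA; do 3!congr (_ && _).
  apply/andP/eqP => [[/eqP <- jD]|->].
    by apply/esym/setDidPl; rewrite disjoint_sym disjoints1.
  by rewrite jS; split=> //; apply/eqP/setDidPl; rewrite disjoint_sym disjoints1.
apply/andP/eqP => [[/eqP <- jD]|->].
  by rewrite setD1K.
by rewrite setU1K // setU11.
Qed.

(** The sum depends on [T] only through its size: the choice of the arc leaving the
    last source, among the [h] targets of [T], has total weight
    [\sum_l a l (h - 1 - l)] by [sum_ranks]. *)
Lemma prefix_sum_histories alpha m T :
    (forall k : nat, alpha k.*2.+1 = b k) ->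
    (forall k : nat, alpha k.+1.*2 = \sum_(0 <= l < k.+1) a l (k - l)%N) ->
    (m <= n)%N -> (forall k, k \in T -> (m <= k)%N) ->
  prefix_sum m T = histories alpha #|T| m.
Proof.
move=> alpha_odd alpha_even; elim: m T => [|m IHm] T le_mn T_ge.
  exact: prefix_sum0.
pose j := Ordinal le_mn.
have jT : j \notin T by apply/negP=> /T_ge; rewrite ltnn.
have T_ge' x k : k \in T :\ x -> (m <= k)%N by case/setD1P=> _ /T_ge/ltnW.
rewrite (@prefix_sumS j) // big_setU1 //=.
have TDj : T :\ j = T by apply/setDidPl; rewrite disjoint_sym disjoints1.
have step x : prefix_sum m (T :\ x) + prefix_sum m (j |: (T :\ x)) =
    histories alpha #|T :\ x| m + histories alpha #|T :\ x|.+1 m.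
  rewrite (IHm (T :\ x)) ?(ltnW le_mn) //; last exact: T_ge'.
  rewrite (IHm (j |: _)) ?(ltnW le_mn) //; last by move=> k /setU1P[->|/T_ge'].
  by rewrite cardsU1 in_setD1 (negbTE jT) andbF.
rewrite step TDj {1}/step_weight eqxx alpha_odd; congr (_ + _).
case cardT: #|T| => [|h].
  by rewrite (cards0_eq cardT) big_set0.
have cardTD x : x \in T -> #|T :\ x| = h.
  by move=> xT; move: cardT; rewrite (cardsD1 x) xT => -[].
transitivity (\sum_(x in T) a #|[set k in T | (k < x)%N]| #|[set k in T | (x < k)%N]| *
    (histories alpha h m + histories alpha h.+1 m)).
  apply: eq_bigr => x xT; rewrite step cardTD // /step_weight ifF; last first.
    by apply: contraNF jT => /eqP e; rewrite -[j]e.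
  congr (a _ _ * _); apply: eq_card => k; rewrite !inE;
    by case: (eqVneq k x) => [->|_] //=; rewrite ltnn !andbF.
by rewrite -mulr_suml sum_ranks cardT alpha_even subn1.
Qed.

End Weights.

(** * Set partitions as arc maps *)

Section LastElements.
Variable n : nat.
Implicit Types (f g : {ffun 'I_n -> 'I_n}) (i j k x y : 'I_n).

(** The last element of the chain of [x]: as chains have at most [n] elements, [n]
    iterations reach it. *)
Definition last_of f x : 'I_n := iter n f x.

Section IncreasingMap.
Variable f : {ffun 'I_n -> 'I_n}.
Hypothesis f_ge : forall i, (i <= f i)%N.

Lemma iter_ge m x : (x <= iter m f x)%N.
Proof. by elim: m => //= m IHm; apply: leq_trans IHm (f_ge _). Qed.

Lemma iter_fixed_or_far m x : f (iter m f x) = iter m f x \/ (x + m <= iter m f x)%N.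
Proof.
elim: m => [|m [IHm|IHm]]; first by right; rewrite addn0.
  by left; rewrite /= !IHm.
case: (eqVneq (f (iter m f x)) (iter m f x)) => [e|ne]; first by left; rewrite /= !e.
right; rewrite /= addnS; apply: leq_ltn_trans IHm _.
by rewrite ltn_neqAle eq_sym f_ge andbT.
Qed.

Lemma last_of_fixed x : f (last_of f x) = last_of f x.
Proof.
case: (iter_fixed_or_far n x) => //; rewrite leqNgt.
by rewrite (leq_trans (ltn_ord _)) // leq_addl.
Qed.

Lemma last_of_ge x : (x <= last_of f x)%N.
Proof. exact: iter_ge. Qed.

Lemma last_of_step x : last_of f (f x) = last_of f x.
Proof. by rewrite /last_of -iterSr /=; apply: last_of_fixed. Qed.

Lemma last_of_id x : f x = x -> last_of f x = x.
Proof. by move=> fx; rewrite /last_of; elim: (X in iter X) => //= m ->. Qed.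
End IncreasingMap.

(** Consecutive elements of a chain are also consecutive among the elements with
    the same last element, although these are not known yet to be on the same
    chain.  Otherwise let [y] be strictly between [x] and [f x]; by induction
    on the distance from [x] to the end, no iterate of [y] jumps over [f x],
    and none equals [f x] as [f] is injective on sources.  So the chain of [y]
    would end before [f x], although it has the same last element. *)
Lemma no_skip f x y : arc_map f ->
  (x < y)%N -> last_of f x = last_of f y -> (f x <= y)%N.
Proof.
case/arc_mapP=> f_ge f_inj.
move: {2}(n - x)%N (leqnn (n - x)%N) => d; elim: d x y => [|d IHd] x y le_d xy eqL.
  by move: le_d; rewrite leqn0 subn_eq0 leqNgt ltn_ord.
case: (leqP (f x) y) => // lt_yfx.
have it m : (y <= iter m f y)%N /\ (iter m f y < f x)%N.
  elim: m => [|m [ge_y lt_fx]] //=; split; first exact: leq_trans ge_y (f_ge _).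
  have Lm : last_of f (iter m f y) = last_of f (f x).
    rewrite last_of_step // eqL; elim: m {ge_y lt_fx} => //= m IHm.
    by rewrite last_of_step.
  have le_fx : (f (iter m f y) <= f x)%N.
    apply: IHd => //; have := ltn_ord (iter m f y); lia.
  rewrite ltn_neqAle le_fx andbT; apply/eqP => /val_inj eq_f.
  have xm : (x < iter m f y)%N by lia.
  by have := f_inj _ _ xm (esym eq_f); move=> fm; move: lt_fx; rewrite -eq_f fm ltnn.
have [_] := it n; rewrite -/(last_of f y) -eqL -(last_of_step f_ge x) ltnNge.
by rewrite last_of_ge.
Qed.

Definition block_next P x : 'I_n :=
  if [pick y in pblock P x | (x < y)%N] is Some y0 then
    [arg min_(y < y0 in [set z in pblock P x | (x < z)%N]) (y : nat)] else x.

Variant block_next_spec P x : 'I_n -> Prop :=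
| NextLast of (forall y, y \in pblock P x -> (y <= x)%N) : block_next_spec P x x
| NextElt y of y \in pblock P x & (x < y)%N
    & (forall z, z \in pblock P x -> (x < z)%N -> (y <= z)%N) : block_next_spec P x y.

Lemma block_nextP P x : block_next_spec P x (block_next P x).
Proof.
rewrite /block_next; case: pickP => [y0 /andP[y0P xy0] | none].
  have y0S : y0 \in [set z in pblock P x | (x < z)%N] by rewrite inE y0P.
  case: (@arg_minnP _ y0 [in [set z in pblock P x | (x < z)%N]] val y0S).
  move=> y; rewrite inE => /andP[yP xy] min_y; apply: NextElt => // z zP xz.
  by apply: min_y; rewrite inE zP.
by apply: NextLast => y yP; rewrite leqNgt; have := none y; rewrite /= yP => /= ->.
Qed.

Definition block_next_map P : {ffun 'I_n -> 'I_n} := [ffun x => block_next P x].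

(** For an arc map, of two elements with the same last element, one is an iterate of the other,
    since distinct sources have distinct images; so the blocks are the maximal
    chains. *)
Definition last_partition f := preim_partition (last_of f) [set: 'I_n].

Lemma pblock_last_partition f x y :
  (y \in pblock (last_partition f) x) = (last_of f x == last_of f y).
Proof.
by rewrite pblock_equivalence_partition ?inE // => u v w _ _ _; split=> // /eqP->.
Qed.

Section Partition.
Variable P : {set {set 'I_n}}.
Hypothesis partP : partition P [set: 'I_n].

Let tiP : trivIset P. Proof. by case/and3P: partP. Qed.
Let coverP x : x \in cover P. Proof. by case/and3P: partP => /eqP-> _ _; rewrite inE. Qed.

Lemma mem_own_block x : x \in pblock P x. Proof. by rewrite mem_pblock. Qed.

Lemma block_sym x y : (y \in pblock P x) = (x \in pblock P y).
Proof. by rewrite -!eq_pblock // eq_sym. Qed.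

Lemma block_next_in x : block_next P x \in pblock P x.
Proof. by case: block_nextP => // _; apply: mem_own_block. Qed.

Lemma block_next_map_ge x : (x <= block_next_map P x)%N.
Proof. by rewrite ffunE; case: block_nextP => // y _ /ltnW. Qed.

Lemma arc_block_next_map : arc_map (block_next_map P).
Proof.
apply/arc_mapP; split=> [x|x y xy]; first exact: block_next_map_ge.
rewrite !ffunE => eq_xy; case: (block_nextP P y) eq_xy => // z zy yz _ eq_xz.
have zx : z \in pblock P x by rewrite -eq_xz block_next_in.
have yx : y \in pblock P x.
  by rewrite -(same_pblock tiP zx) block_sym.
case: (block_nextP P x) eq_xz => [/(_ _ yx) | w wx xw min_w ewz].
  by rewrite leqNgt xy.
by have := min_w y yx xy; rewrite ewz leqNgt yz.
Qed.

Lemma last_of_next_block x : last_of (block_next_map P) x \in pblock P x.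
Proof.
rewrite /last_of; elim: (X in iter X) => [|m IHm] /=; first exact: mem_own_block.
by rewrite ffunE -(same_pblock tiP IHm) block_next_in.
Qed.

(** The iteration of [block_next_map P] stays in the block and only stops at
    its largest element; hence the blocks of [P] are recovered in
    [block_next_mapK]. *)
Lemma last_of_next_max x y : y \in pblock P x -> (y <= last_of (block_next_map P) x)%N.
Proof.
have := last_of_fixed block_next_map_ge x; rewrite ffunE.
have Lx := last_of_next_block x; rewrite -(same_pblock tiP Lx).
by case: block_nextP => [|z _ lt_z _ ez]; [auto | move: lt_z; rewrite ez ltnn].
Qed.

Lemma block_next_mapK : last_partition (block_next_map P) = P.
Proof.
rewrite -[RHS](preim_partition_pblock partP); apply: eq_in_imset => x _.
apply/setP=> y; rewrite !inE eq_pblock //; apply/eqP/idP => [eqL | yx].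
  by rewrite -(same_pblock tiP (last_of_next_block x)) block_sym eqL last_of_next_block.
have bxy := same_pblock tiP yx.
apply/val_inj/eqP; rewrite /= eqn_leq !last_of_next_max //.
  by rewrite -bxy last_of_next_block.
by rewrite bxy last_of_next_block.
Qed.

End Partition.

Lemma last_partitionK f : arc_map f -> block_next_map (last_partition f) = f.
Proof.
move=> arc_f; have [f_ge _] := arc_mapP _ arc_f.
apply/ffunP=> x; rewrite ffunE; case: block_nextP => [max_x | y].
  apply/val_inj/eqP; rewrite /= eqn_leq f_ge /= max_x //.
  by rewrite pblock_last_partition last_of_step.
rewrite pblock_last_partition => /eqP eqL xy min_y.
apply/val_inj/eqP; rewrite /= eqn_leq no_skip // andbT.
rewrite min_y // ?pblock_last_partition ?last_of_step //.
rewrite ltn_neqAle f_ge andbT; apply/eqP=> /val_inj/esym fx.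
by have := last_of_ge f_ge y; rewrite -eqL last_of_id // leqNgt xy.
Qed.

Lemma last_partitionP f : partition (last_partition f) [set: 'I_n].
Proof. exact: preim_partitionP. Qed.

End LastElements.

(** * The statistics of a partition in terms of its arcs *)

Section Statistics.
Variables (n : nat) (P : {set {set 'I_n}}).
Hypothesis partP : partition P [set: 'I_n].
Implicit Types (i j k l x y : 'I_n).

Let tiP : trivIset P. Proof. by case/and3P: partP. Qed.
Let coverP x : x \in cover P. Proof. by case/and3P: partP => /eqP-> _ _; rewrite inE. Qed.
Let f := block_next_map P.

Lemma exists_own_block (Q : pred {set 'I_n}) x :
  [exists B in P, (x \in B) && Q B] = Q (pblock P x).
Proof.
apply/existsP/idP => [[B /and3P[PB xB]]|QB]; first by rewrite (def_pblock tiP PB xB).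
by exists (pblock P x); rewrite pblock_mem // mem_pblock coverP.
Qed.

Lemma edgeE x y : edge P x y = (x < y)%N && (f x == y).
Proof.
rewrite /edge exists_own_block ffunE; apply/and3P/andP => [[yB xy]|[xy /eqP fxy]].
  move=> /forall_inP no_mid; split=> //; case: block_nextP => [/(_ y yB)|z zB xz min_z].
    by rewrite leqNgt xy.
  have := no_mid z zB; rewrite xz /= -leqNgt => yz.
  by apply/eqP/val_inj/eqP; rewrite /= eqn_leq yz min_z.
rewrite -{}fxy in xy *.
case: block_nextP xy => [_|z zB xz min_z _]; first by rewrite ltnn.
split=> //; apply/forall_inP => k kB; rewrite negb_and -!leqNgt orbC.
by case: (ltnP x k) => [/(min_z k kB)->|]; rewrite ?orbT.
Qed.

Let source i k x y : (i < k)%N -> (x < i)%N -> (y < i)%N ->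
  f x = k -> f y = k -> x = y.
Proof.
move=> ik xi yi; apply: arc_source; first exact: arc_block_next_map.
  exact: ltn_trans xi ik.
exact: ltn_trans yi ik.
Qed.

(** The target determines the whole arc, so that the arcs over [i] can be counted
    by their targets.  The same holds for [cr] and [ne], where moreover the arc
    leaving [i] is the only choice for the second arc of the pair. *)
Lemma qne_covering i : qne P i = #|covering f i|.
Proof.
rewrite /qne -(@card_in_imset _ _ (fun p : 'I_n * 'I_n => p.2)); last first.
  move=> [x k] [y l]; rewrite !inE !edgeE => /and3P[xi ik /andP[_ /eqP fx]].
  move=> /and3P[yi _ /andP[_ /eqP fy]] /= kl; rewrite -kl in fy *.
  by rewrite (source ik xi yi fx fy).
apply: eq_card => k; apply/imsetP/coveringP => [[[x l]]|[ik [x xi fx]]].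
  rewrite inE edgeE => /and3P[xi il /andP[_ /eqP fx]] -> /=.
  by split=> //; exists x.
by exists (x, k) => //; rewrite inE edgeE xi ik fx eqxx (ltn_trans xi ik).
Qed.

Lemma cr_covering i : f i != i ->
  cr P i = #|[set k in covering f i | (k < f i)%N]|.
Proof.
move=> fi; have i_fi : (i < f i)%N.
  by rewrite ltn_neqAle eq_sym fi block_next_map_ge.
rewrite /cr -(@card_in_imset _ _ (fun p : 'I_n * 'I_n * 'I_n => p.1.2)); last first.
  move=> [[x k] l] [[y k'] l']; rewrite !inE !edgeE.
  case/and5P=> xi ik _ /andP[_ /eqP fx] /andP[_ /eqP <-].
  case/and5P=> yi _ _ /andP[_ /eqP fy] /andP[_ /eqP <-] /= kk; rewrite -kk in fy *.
  by rewrite (source ik xi yi fx fy).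
apply: eq_card => k; apply/imsetP/idP => [[[[x k'] l]]|].
  rewrite inE !edgeE => /and5P[xi ik kl /andP[_ /eqP fx] /andP[_ /eqP fil]] -> /=.
  by rewrite inE fil kl andbT; apply/coveringP; split=> //; exists x.
rewrite inE => /andP[/coveringP[ik [x xi fx]] k_fi].
exists (x, k, f i) => //.
by rewrite inE !edgeE xi ik k_fi fx i_fi !eqxx (ltn_trans xi ik).
Qed.

Lemma ne_covering i : f i != i ->
  ne P i = #|[set k in covering f i | (f i < k)%N]|.
Proof.
move=> fi; have i_fi : (i < f i)%N.
  by rewrite ltn_neqAle eq_sym fi block_next_map_ge.
rewrite /ne -(@card_in_imset _ _ (fun p : 'I_n * 'I_n * 'I_n => p.2)); last first.
  move=> [[x k] l] [[y k'] l']; rewrite !inE !edgeE.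
  case/and5P=> xi ik kl /andP[_ /eqP fx] /andP[_ /eqP <-].
  case/and5P=> yi _ _ /andP[_ /eqP fy] /andP[_ /eqP <-] /= ll; rewrite -ll in fy *.
  by rewrite (source (ltn_trans ik kl) xi yi fx fy).
apply: eq_card => l; apply/imsetP/idP => [[[[x k] l']]|].
  rewrite inE !edgeE => /and5P[xi ik kl /andP[_ /eqP fx] /andP[_ /eqP fik]] -> /=.
  rewrite inE fik kl andbT; apply/coveringP; split; last by exists x.
  exact: ltn_trans ik kl.
rewrite inE => /andP[/coveringP[il [x xi fx]] fi_l].
exists (x, f i, l) => //.
by rewrite inE !edgeE xi fi_l fx i_fi !eqxx (ltn_trans xi il).
Qed.

Section BlockRole.
Variable i : 'I_n.
Let B := pblock P i.
Let first := [forall j in B, (i <= j)%N].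
Let last := [forall j in B, (j <= i)%N].

Lemma openerE : opener P i = (1 < #|B|)%N && first.
Proof.
rewrite -(exists_own_block (fun B => (1 < #|B|)%N && [forall j in B, (i <= j)%N])).
by apply: eq_existsb => C; congr (_ && _); apply: andbCA.
Qed.

Lemma closerE : closer P i = (1 < #|B|)%N && last.
Proof.
rewrite -(exists_own_block (fun B => (1 < #|B|)%N && [forall j in B, (j <= i)%N])).
by apply: eq_existsb => C; congr (_ && _); apply: andbCA.
Qed.

Lemma insiderE : insider P i = [&& (2 < #|B|)%N, ~~ first & ~~ last].
Proof.
rewrite /insider openerE closerE.
have -> : [exists C in P, (2 < #|C|)%N && (i \in C)] = (2 < #|B|)%N.
  rewrite -(exists_own_block (fun B => 2 < #|B|)%N).
  by apply: eq_existsb => C; congr (_ && _); apply: andbC.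
by case: ltnP => //= /ltnW ->.
Qed.

Lemma singletonE : singleton P i = (#|B| == 1%N).
Proof.
rewrite /singleton; apply/idP/cards1P => [iP|[x Bx]].
  by exists i; apply: def_pblock => //; rewrite inE.
have: i \in B by rewrite mem_pblock coverP.
by rewrite Bx inE => /eqP ->; rewrite -Bx pblock_mem.
Qed.

Lemma last_nextE : last = (f i == i).
Proof.
rewrite ffunE; apply/forall_inP/eqP => [max_i|].
  by case: block_nextP => // y yB; rewrite ltnNge max_i.
by case: block_nextP => // y _ iy _ yi; move: iy; rewrite yi ltnn.
Qed.

(** The only element of a block is both first and last; an element that is neither
    has a neighbour on each side, so that its block has at least three
    elements.  Thus each element plays exactly one of the four roles. *)
Lemma first_last_card :
  [/\ (#|B| == 1%N) = first && last & ~~ first -> ~~ last -> (2 < #|B|)%N].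
Proof.
have iB : i \in B by rewrite mem_pblock coverP.
split.
  apply/cards1P/andP => [[x Bx]|[/forall_inP min_i /forall_inP max_i]].
    have /eqP ix : i == x by rewrite Bx inE in iB.
    by split; apply/forall_inP=> y; rewrite Bx inE -ix => /eqP->.
  exists i; apply/setP=> y; rewrite inE; apply/idP/eqP => [yB|-> //].
  by apply/val_inj/eqP; rewrite /= eqn_leq min_i ?max_i.
rewrite !negb_forall => /existsP[x]; rewrite negb_imply -ltnNge => /andP[xB xi].
case/existsP=> y; rewrite negb_imply -ltnNge => /andP[yB iy].
have neq (u v : 'I_n) : (u < v)%N -> v != u.
  by move=> uv; rewrite -(inj_eq val_inj) /= gtn_eqF.
rewrite (cardsD1 i) iB (cardsD1 x) (cardsD1 y) !inE xB yB.
by rewrite (eq_sym x) !neq // (ltn_trans xi iy).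
Qed.

End BlockRole.

End Statistics.

Section Weight.
Variables (R : comNzRingType) (a : nat -> nat -> R) (b : nat -> R) (n : nat).

(** With [d = a] and [e = b], openers and insiders (the elements with an outgoing
    arc) have the same weights, and so do closers and singletons (those
    without). *)
Lemma role_weight (P : {set {set 'I_n}}) i : partition P [set: 'I_n] ->
  (if opener P i then a (cr P i) (ne P i) else 1) *
  (if closer P i then b (qne P i) else 1) *
  (if insider P i then a (cr P i) (ne P i) else 1) *
  (if singleton P i then b (qne P i) else 1) = arc_weight a b (block_next_map P) i.
Proof.
move=> partP; rewrite /arc_weight /step_weight qne_covering //.
have [card1 card3] := first_last_card partP i.
rewrite openerE // closerE // insiderE // singletonE // card1.
have B_gt0 : (0 < #|pblock P i|)%N.
  by rewrite card_gt0; apply/set0Pn; exists i; apply: mem_own_block.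
have gt1 : (1 < #|pblock P i|)%N = ~~ (#|pblock P i| == 1%N).
  by rewrite ltn_neqAle B_gt0 andbT eq_sym.
rewrite gt1 card1 -last_nextE //.
case: (boolP [forall j in pblock P i, (j <= i)%N]) => lst.
  rewrite andbT andbF andbT /=; case: [forall j in pblock P i, (i <= j)%N];
    by rewrite /= ?andbF ?mul1r ?mulr1.
have fi : block_next_map P i != i by rewrite -last_nextE.
rewrite !andbF !andbT -cr_covering // -ne_covering //=.
case: (boolP [forall j in pblock P i, (i <= j)%N]) => frst.
  by rewrite /= andbF !mulr1.
by rewrite card3 //= !mul1r mulr1.
Qed.

Lemma Bpoly_arc_maps :
  Bpoly a b a b n = \sum_(f : {ffun 'I_n -> 'I_n} | arc_map f) \prod_i arc_weight a b f i.
Proof.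
rewrite /Bpoly (reindex_onto (@last_partition n) (@block_next_map n)) /=; last first.
  by move=> P partP; apply: block_next_mapK.
apply: eq_big => [f|f].
  rewrite last_partitionP /=; apply/eqP/idP => [<-|]; last exact: last_partitionK.
  exact/arc_block_next_map/last_partitionP.
rewrite last_partitionP /= => /eqP fK.
rewrite -[in RHS]fK !(big_mkcond (fun i => _ (last_partition f) i)) -!big_split /=.
by apply: eq_bigr => i _; apply: role_weight; apply: last_partitionP.
Qed.

Lemma Bpoly_prefix_sum : Bpoly a b a b n = prefix_sum a b n (set0 : {set 'I_n}).
Proof.
rewrite Bpoly_arc_maps; apply: eq_big => [f|f _].
  case: (arc_map f) => //=; apply/esym/andP; split.
    by apply/fixed_fromP=> i; rewrite leqNgt ltn_ord.
  by apply/eqP/setP=> k; rewrite [RHS]inE; apply/danglingP=> -[]; rewrite leqNgt ltn_ord.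
by apply: eq_bigl => i; rewrite ltn_ord.
Qed.
End Weight.

Theorem theorem3p10 (R : comNzRingType) (a : nat -> nat -> R) (b : nat -> R)
    (alpha : nat -> R)
    (alpha_odd : forall k : nat, (1 <= k)%N -> alpha (2 * k - 1)%N = b (k - 1)%N)
    (alpha_even : forall k : nat, (1 <= k)%N ->
       alpha (2 * k)%N = \sum_(0 <= l < k) a l (k - 1 - l)%N) :
  has_sfrac (fun n => Bpoly a b a b n) alpha.
Proof.
move=> n; have [M cvM] := has_sfrac_path_sum alpha n.
exists M => m /cvM ->; rewrite Bpoly_prefix_sum (@prefix_sum_histories _ _ _ _ alpha) //.
- by rewrite cards0 (histories_path_sum alpha 0 n) big_ord0 mul1r.
- by move=> k; have := alpha_odd k.+1 isT; rewrite mul2n doubleS !subn1.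
- by move=> k; rewrite -mul2n alpha_even // subn1.
- by move=> k; rewrite inE.
Qed.
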